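(* Let $X,Y$ be normed spaces, let $\varphi:X\times Y\to(-\infty,\infty]$ and $G:X\rightrightarrows Y$, and let $\mu(x)=\inf\{\varphi(x,y)\mid y\in G(x)\}$ and $M(x)=\{y\in G(x)\mid\varphi(x,y)=\mu(x)\}$. Let $\mu$ be finite at some $\bar x\in\operatorname{dom}M$, and let $\bar y\in M(\bar x)$. Suppose that $\varphi$ is Fréchet differentiable at $(\bar x,\bar y)$. Then, with $(x^*,y^* ):=\nabla\varphi(\bar x,\bar y)$, $$\widehat\partial\mu(\bar x)=x^*+\widehat D^*G(\bar x,\bar y)(y^* )\quad\text{and}\quad\widehat\partial^{\infty}\mu(\bar x)=\widehat D^*G(\bar x,\bar y)(0),$$ provided that at least one of the following conditions is satisfied: (a) $G$ is semilocally nearly-isolated calm at $(\bar x,\bar y)$. (b) $G$ is locally nearly-isolated calm at $(\bar x,\bar y)$, and for every $\varepsilon>0$ there exists $\gamma>0$ such that $$\mu(x)=\inf_{y\in G(x)}\varphi(x,y)=\inf_{y\in G(x)\cap\mathbb B(\bar y,\varepsilon)}\varphi(x,y)\quad\text{for all }x\in\mathbb B(\bar x,\gamma).$$ (c) The solution mapping $M:\operatorname{dom}G\rightrightarrows Y$ admits an upper Lipschitzian selection at $(\bar x,\bar y)$.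
   Context: All spaces are normed; $X^*$ is the topological dual of $X$; $\mathbb B(\bar x,r)$ is the open ball, $\overline{\mathbb B}_Y$ is the closed unit ball of $Y$; product spaces carry the sum norm, e.g. $\|(x,y)\|=\|x\|+\|y\|$. For $F:X\rightrightarrows Y$, $\operatorname{dom}F=\{x\mid F(x)\neq\emptyset\}$ and $\operatorname{gph}F=\{(x,y)\mid y\in F(x)\}$; for an extended-real-valued $f$ on $Z$, $\operatorname{epi}f=\{(z,\alpha)\in Z\times\mathbb R\mid\alpha\ge f(z)\}$. The infimum over the empty set is $+\infty$. Regular subdifferential: for $f$ finite at $\bar z$, $\widehat\partial f(\bar z)$ is the set of $z^*\in Z^*$ such that for every $\varepsilon>0$ there is $\gamma>0$ with $f(z)-f(\bar z)-\langle z^*,z-\bar z\rangle\ge-\varepsilon\|z-\bar z\|$ for all $z\in\mathbb B(\bar z,\gamma)$. Regular normal cone: for $S\subset Z$ and $\bar z\in S$, $\widehat N(\bar z;S)=\{z^*\in Z^*\mid \limsup_{z\to\bar z,\,z\in S}\langle z^*,\frac{z-\bar z}{\|z-\bar z\|}\rangle\le0\}$. Singular regular subdifferential: for $f$ finite at $\bar z$, $\widehat\partial^{\infty}f(\bar z)=\{z^*\in Z^*\mid(z^*,0)\in\widehat N((\bar z,f(\bar z));\operatorname{epi}f)\}$. Regular coderivative: for $(\bar x,\bar y)\in\operatorname{gph}G$ and $y^*\in Y^*$, $\widehat D^*G(\bar x,\bar y)(y^* )=\{x^*\in X^*\mid (x^*,-y^* )\in\widehat N((\bar x,\bar y);\operatorname{gph}G)\}$.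 Nearly-isolated calmness at $(\bar x,\bar y)\in\operatorname{gph}F$: $F:X\rightrightarrows Y$ is locally nearly-isolated calm if there are $L>0$, $\gamma>0$ with $F(u)\cap\mathbb B(\bar y,\gamma)\subset\{\bar y\}+L\|u-\bar x\|\overline{\mathbb B}_Y$ for all $u\in\mathbb B(\bar x,\gamma)\setminus\{\bar x\}$; it is semilocally nearly-isolated calm if there are $L>0$, $\gamma>0$ with $F(u)\subset\{\bar y\}+L\|u-\bar x\|\overline{\mathbb B}_Y$ for all $u\in\mathbb B(\bar x,\gamma)\setminus\{\bar x\}$. Upper Lipschitzian selection: $F:D\rightrightarrows Y$, $D\subset X$, admits an upper Lipschitzian selection at $(\bar x,\bar y)\in\operatorname{gph}F$ if there is a single-valued $h:D\to Y$ with $h(\bar x)=\bar y$, $h(x)\in F(x)$ for all $x\in D$ in a neighborhood of $\bar x$, and $h$ calm at $\bar x$, i.e., there are $r>0$, $\ell\ge0$ with $\|h(x)-h(\bar x)\|\le\ell\|x-\bar x\|$ for all $x\in\mathbb B(\bar x,r)\cap D$. *)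

(* Defs.v *)
From HB Require Import structures.
From mathcomp Require Import all_boot all_order all_algebra.
From mathcomp Require Import all_classical all_reals all_analysis.

Set Implicit Arguments.
Unset Strict Implicit.
Unset Printing Implicit Defensive.

Import Order.TTheory GRing.Theory Num.Theory.
Import numFieldNormedType.Exports.

Local Open Scope classical_set_scope.
Local Open Scope ring_scope.

(* The product normed space with the sum norm |(x, y)| = |x| + |y|. An alias of
   X * Y is needed because the library equips X * Y itself with the max norm. *)
Definition l1prod (R : realType) (X Y : normedModType R) : Type := (X * Y)%type.

Section L1Prod.
Context (R : realType) (X Y : normedModType R).

HB.instance Definition _ := GRing.Lmodule.copy (l1prod X Y) (X * Y)%type.

Definition l1norm (p : l1prod X Y) : R := `|p.1| + `|p.2|.

Lemma ler_l1normD p q : l1norm (p + q) <= l1norm p + l1norm q.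
Proof. by rewrite /l1norm addrACA lerD// ler_normD. Qed.

Lemma l1normZ (a : R) p : l1norm (a *: p) = `|a| * l1norm p.
Proof. by rewrite /l1norm !normrZ mulrDr. Qed.

Lemma l1norm0_eq0 p : l1norm p = 0 -> p = 0.
Proof.
case: p => x y /eqP; rewrite /l1norm paddr_eq0//= => /andP[].
by rewrite !normr_eq0 => /eqP-> /eqP->.
Qed.

HB.instance Definition _ :=
  Lmodule_isNormed.Build R (l1prod X Y) ler_l1normD l1normZ l1norm0_eq0.

Lemma l1prod_normE (p : l1prod X Y) : `|p| = `|p.1| + `|p.2|.
Proof. by []. Qed.

End L1Prod.

Section Duality.
Context (R : realType).

(* The topological dual, as a set of functions. *)
Definition dual (Z : normedModType R) : set (Z -> R) :=
  [set zs : Z -> R | scalar zs /\ continuous zs].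

(* The functional on the product represented by a pair of functionals. *)
Definition pair_functional (X Y : normedModType R) (xs : X -> R) (ys : Y -> R) :
    l1prod X Y -> R :=
  fun p => xs p.1 + ys p.2.

End Duality.

Section SetValued.
Context (R : realType) (X Y : normedModType R).
Implicit Types (F : X -> set Y) (xbar : X) (ybar : Y).

Definition dom F : set X := [set x | F x !=set0].

Definition gph F : set (l1prod X Y) := [set p | F p.1 p.2].

Definition locally_nearly_isolated_calm F xbar ybar : Prop :=
  exists L gamma : R, [/\ 0 < L, 0 < gamma &
    forall u, (ball xbar gamma `\ xbar) u ->
      F u `&` ball ybar gamma `<=`
        [set ybar + (L * `|u - xbar|) *: b | b in [set b : Y | `|b| <= 1]]].

Definition semilocally_nearly_isolated_calm F xbar ybar : Prop :=
  exists L gamma : R, [/\ 0 < L, 0 < gamma &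
    forall u, (ball xbar gamma `\ xbar) u ->
      F u `<=`
        [set ybar + (L * `|u - xbar|) *: b | b in [set b : Y | `|b| <= 1]]].

(* Concerns F restricted to D: the selection h is represented by a total
   function whose values outside D are irrelevant. *)
Definition upper_Lipschitzian_selection (D : set X) F xbar ybar : Prop :=
  exists h : X -> Y,
    [/\ h xbar = ybar,
        \forall x \near xbar, D x -> F x (h x) &
        exists r l : R, [/\ 0 < r, 0 <= l &
          forall x, (ball xbar r `&` D) x ->
            `|h x - h xbar| <= l * `|x - xbar|]].

End SetValued.

Section VariationalAnalysis.
Context (R : realType).

Definition regular_normal_cone (Z : normedModType R) (zbar : Z) (S : set Z) :
    set (Z -> R) :=
  [set zs | dual zs /\
    (limf_esup (fun z => (zs (`|z - zbar|^-1 *: (z - zbar)))%:E)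
       (within S zbar^') <= 0)%E].

(* Meant for f finite at zbar; f may take both infinite values elsewhere. *)
Definition regular_subdifferential (Z : normedModType R) (f : Z -> \bar R)
    (zbar : Z) : set (Z -> R) :=
  [set zs | dual zs /\
    forall eps : R, 0 < eps -> exists2 gamma : R, 0 < gamma &
      forall z, ball zbar gamma z ->
        (f z - f zbar - (zs (z - zbar))%:E >= (- eps * `|z - zbar|)%:E)%E].

Definition epi (Z : normedModType R) (f : Z -> \bar R) : set (l1prod Z R) :=
  [set p | (f p.1 <= p.2%:E)%E].

Definition singular_regular_subdifferential (Z : normedModType R)
    (f : Z -> \bar R) (zbar : Z) : set (Z -> R) :=
  [set zs | dual zs /\
    regular_normal_cone ((zbar, fine (f zbar)) : l1prod Z R) (epi f)
      (pair_functional zs (cst 0))].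

Definition regular_coderivative (X Y : normedModType R) (G : X -> set Y)
    (xbar : X) (ybar : Y) (ys : Y -> R) : set (X -> R) :=
  [set xs | dual xs /\
    regular_normal_cone ((xbar, ybar) : l1prod X Y) (gph G)
      (pair_functional xs (\- ys))].

(* Frechet differentiability of an extended-real-valued function; it forces
   finiteness around the point. *)
Definition frechet_differentiable (Z : normedModType R) (f : Z -> \bar R)
    (zbar : Z) : Prop :=
  (\forall z \near zbar, f z \is a fin_num) /\ differentiable (fine \o f) zbar.

Definition gradient (Z : normedModType R) (f : Z -> \bar R) (zbar : Z) :
    Z -> R :=
  'd (fine \o f) zbar.

(* The two components of the gradient of a function on a product. *)
Definition gradient1 (X Y : normedModType R) (f : l1prod X Y -> \bar R)
    (zbar : l1prod X Y) : X -> R :=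
  fun x => gradient f zbar (x, 0).

Definition gradient2 (X Y : normedModType R) (f : l1prod X Y -> \bar R)
    (zbar : l1prod X Y) : Y -> R :=
  fun y => gradient f zbar (0, y).

Context (X Y : normedModType R).

Definition marginal (phi : l1prod X Y -> \bar R) (G : X -> set Y) (x : X) :
    \bar R :=
  ereal_inf [set phi (x, y) | y in G x].

Definition solution_map (phi : l1prod X Y -> \bar R) (G : X -> set Y) (x : X) :
    set Y :=
  [set y | G x y /\ phi (x, y) = marginal phi G x].

End VariationalAnalysis.

(* Main.v *)
(* Each of the conditions (a), (b), (c) yields a constant L such that, for x
   near xbar, the infimum defining mu(x) may be restricted to those y in G(x)
   with |y - ybar| <= L |x - xbar|. On such pairs |(x, y) - (xbar, ybar)| is at
   most (1 + L) |x - xbar|, so the normal inequality on gph G, combined with the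
   first-order expansion of phi, turns into the subgradient inequality for mu
   (resp. the normal inequality on epi mu). The opposite inclusions need no
   calmness: mu(x) <= phi(x, y) on gph G, so the expansion of phi turns a
   subgradient of mu into a normal to gph G, and (x, phi(x, y)) is a point of
   epi mu whose distance to (xbar, mu(xbar)) is at most a constant times
   |(x, y) - (xbar, ybar)|. *)

Require Import Defs.
From HB Require Import structures.
From mathcomp Require Import all_boot all_order all_algebra.
From mathcomp Require Import all_classical all_reals all_analysis.
From mathcomp Require Import ring lra.

Set Implicit Arguments.
Unset Strict Implicit.
Unset Printing Implicit Defensive.

Import Order.TTheory GRing.Theory Num.Theory.
Import numFieldNormedType.Exports.

Local Open Scope classical_set_scope.
Local Open Scope ring_scope.

(** * Norm neighbourhoods and the topological dual *)

Lemma near_normP (R : realType) (Z : normedModType R) (z : Z) (P : set Z) :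
  (\forall u \near z, P u) <->
  exists2 d : R, 0 < d & forall u, `|u - z| < d -> P u.
Proof.
split=> [/nbhs_normP[d /= d0 dP]|[d d0 dP]].
  by exists d => // u ud; apply: dP; rewrite /= distrC.
by apply/nbhs_normP; exists d => // u /=; rewrite distrC; exact: dP.
Qed.

Section Functionals.
Context (R : realType).
Implicit Types Z X Y : normedModType R.

Lemma scalar_additive Z (zs : Z -> R) : scalar zs ->
  [/\ zs 0 = 0, (forall a z, zs (a *: z) = a * zs z) &
      forall z w, zs (z + w) = zs z + zs w].
Proof.
move=> lin; have zs0 : zs 0 = 0.
  by have := lin (-1) 0 0; rewrite scaler0 addr0 mulN1r addNr.
split=> // [a z|z w]; first by rewrite -[a *: z]addr0 lin zs0 addr0.
by rewrite -[z in LHS]scale1r lin mul1r.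
Qed.

(** A linear functional is continuous exactly when it is bounded. The bound [K] turns the closure
    properties of the dual into norm estimates, and later makes [phi] calm at the reference
    point. *)
Lemma dualP Z (zs : Z -> R) :
  dual zs <-> scalar zs /\ exists2 K : R, 0 < K & forall z, `|zs z| <= K * `|z|.
Proof.
split=> -[lin H]; split => //;
  pose l : {linear Z -> R^o} :=
    HB.pack zs (GRing.isLinear.Build R Z R^o *:%R zs lin).
- have /linear_boundedP[M [_ HM]] : bounded_near l (nbhs (0 : Z)).
    by apply: continuous_linear_bounded; exact: H.
  (* [HM] gives the bound for every constant above [M]; this one exceeds both [M] and 0. *)
  exists (Num.max M 0 + 1); first by rewrite ltr_wpDl// le_max lexx orbT.
  by apply: HM; rewrite ltr_pwDr// le_max lexx.
- apply: (@bounded_linear_continuous _ _ _ l).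
  apply/linear_boundedP; have [K K0 HK] := H.
  near=> r => z; apply: le_trans (HK z) _; rewrite ler_wpM2r//.
Unshelve. all: by end_near. Qed.

Lemma dualD Z (zs ws : Z -> R) : dual zs -> dual ws -> dual (zs \+ ws).
Proof.
move=> /dualP[lz [K K0 HK]] /dualP[lw [L L0 HL]]; apply/dualP; split.
  by move=> a x y /=; rewrite lz lw mulrDr addrACA.
exists (K + L) => [|z /=]; first exact: addr_gt0.
by rewrite mulrDl (le_trans (ler_normD _ _))// lerD.
Qed.

Lemma dualN Z (zs : Z -> R) : dual zs -> dual (\- zs).
Proof.
move=> /dualP[lz [K K0 HK]]; apply/dualP; split.
  by move=> a x y /=; rewrite lz opprD mulrN.
by exists K => // z /=; rewrite normrN.
Qed.

Lemma dual_cst0 Z : dual (cst 0 : Z -> R).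
Proof.
apply/dualP; split=> [a x y|]; first by rewrite /= mulr0 addr0.
by exists 1 => // z; rewrite normr0 mul1r.
Qed.

Lemma dual_pair_functional X Y (xs : X -> R) (ys : Y -> R) :
  dual xs -> dual ys -> dual (pair_functional xs ys).
Proof.
move=> /dualP[lx [K K0 HK]] /dualP[ly [L L0 HL]]; apply/dualP; split.
  by move=> a p q; rewrite /pair_functional/= lx ly mulrDr addrACA.
exists (K + L) => [|p]; first exact: addr_gt0.
rewrite l1prod_normE /pair_functional (le_trans (ler_normD _ _))//.
have := HK p.1; have := HL p.2.
have := mulr_ge0 (ltW L0) (normr_ge0 p.1).
have := mulr_ge0 (ltW K0) (normr_ge0 p.2); lra.
Qed.

Lemma dual_left X Y (zs : l1prod X Y -> R) :
  dual zs -> dual (fun x : X => zs (x, 0)).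
Proof.
move=> /dualP[lz [K K0 HK]]; apply/dualP; split=> [a x y|].
  rewrite -lz; congr (zs _); apply: injective_projections => //=.
  by rewrite scaler0 addr0.
by exists K => // x; apply: le_trans (HK _) _; rewrite l1prod_normE/= normr0 addr0.
Qed.

Lemma dual_right X Y (zs : l1prod X Y -> R) :
  dual zs -> dual (fun y : Y => zs (0, y)).
Proof.
move=> /dualP[lz [K K0 HK]]; apply/dualP; split=> [a x y|].
  rewrite -lz; congr (zs _); apply: injective_projections => //=.
  by rewrite scaler0 addr0.
by exists K => // x; apply: le_trans (HK _) _; rewrite l1prod_normE/= normr0 add0r.
Qed.

(** * Epsilon forms of normals, subgradients and derivatives *)

(** Multiplying the quotient by [|w - z|] clears the denominator, and the punctured neighbourhood
    becomes a full one because both sides vanish at [w = z]. *)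
Lemma regular_normal_coneP Z (z : Z) (S : set Z) (zs : Z -> R) :
  regular_normal_cone z S zs <->
  dual zs /\ forall eps : R, 0 < eps ->
    \forall w \near z, S w -> zs (w - z) <= eps * `|w - z|.
Proof.
split=> -[dz H]; split=> //; have [lin _] := dz;
    have [zs0 zsZ _] := scalar_additive lin.
- move=> eps eps0.
  have : (limf_esup (fun w => (zs (`|w - z|^-1 *: (w - z)))%:E)
       (within S z^') < eps%:E)%E by apply: le_lt_trans H _; rewrite lte_fin.
  (* The upper limit is an infimum of suprema over members of the filter, so some member [V] has its
     supremum below [eps]. *)
  move=> /ereal_inf_lt[_ [V SV <-]] supV.
  have {}SV : \forall w \near z, w != z -> S w -> V w := SV.
  near=> w => Sw.
  have [->|wz] := eqVneq w z; first by rewrite subrr zs0 normr0 mulr0.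
  have Vw : V w by move: wz Sw; near: w.
  have nw0 : 0 < `|w - z| by rewrite normr_gt0 subr_eq0.
  have : ((zs (`|w - z|^-1 *: (w - z)))%:E <= eps%:E)%E.
    by apply: le_trans (ltW supV); apply: ereal_sup_ubound; exists w.
  by rewrite lee_fin zsZ mulrC ler_pdivrMr.
- apply/lee_addgt0Pr => eps eps0; rewrite add0e.
  (* The member of the filter is the set where the desired inequality holds; on it every quotient is
     at most [eps]. *)
  apply: ge_ereal_inf; exists (ereal_sup [set (zs (`|w - z|^-1 *: (w - z)))%:E
      | w in [set w | S w /\ w != z /\ zs (w - z) <= eps * `|w - z|]]).
    eexists; last by [].
    change (\forall w \near z, w != z -> S w ->
      S w /\ w != z /\ zs (w - z) <= eps * `|w - z|).
    by near=> w => wz Sw; split=> //; split=> //; move: Sw; near: w; exact: H.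
  apply/ereal_supP => _ [w [Sw [wz Hw]] <-].
  have nw0 : 0 < `|w - z| by rewrite normr_gt0 subr_eq0.
  by rewrite lee_fin zsZ mulrC ler_pdivrMr.
Unshelve. all: by end_near. Qed.

(** With [f z] finite, [f w] can be isolated: both forms fail at [-oo] and hold at [+oo]. A lower
    bound on [f w] alone can then be compared with infima. *)
Lemma regular_subdifferentialP Z (f : Z -> \bar R) (z : Z) (zs : Z -> R) :
  f z \is a fin_num ->
  regular_subdifferential f z zs <->
  dual zs /\ forall eps : R, 0 < eps -> \forall w \near z,
    ((fine (f z) + zs (w - z) - eps * `|w - z|)%:E <= f w)%E.
Proof.
move=> fz; have bnd w (eps : R) :
    ((- eps * `|w - z|)%:E <= f w - f z - (zs (w - z))%:E)%E =
    ((fine (f z) + zs (w - z) - eps * `|w - z|)%:E <= f w)%E.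
  rewrite -(fineK fz); case: (f w) => [r| |] /=; last by rewrite !addNye.
    by rewrite !lee_fin; apply/idP/idP; lra.
  by rewrite !addye// !leey.
split=> -[dz H]; split=> // eps eps0; have := H _ eps0.
- move=> [d d0 dP]; apply/near_normP; exists d => // w wz.
  by rewrite -bnd; apply: dP; rewrite -ball_normE/= distrC.
- move=> /near_normP[d d0 dP]; exists d => // w.
  by rewrite -ball_normE/= distrC bnd; exact: dP.
Qed.

(** In the sum norm, [(u, v)] lies within [(1 + L) * |u - x|] of [(x, y)]. The neighbourhood of [x]
    is thus uniform in [v]. *)
Lemma near_calm X Y (x : X) (y : Y) (L : R) (P : set (l1prod X Y)) : 0 <= L ->
  (\forall p \near ((x, y) : l1prod X Y), P p) ->
  \forall u \near x, forall v, `|v - y| <= L * `|u - x| -> P (u, v).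
Proof.
move=> L0 /near_normP[d d0 dP]; apply/near_normP.
exists (d / (1 + L)) => [|u ux v vy]; first by rewrite divr_gt0// ltr_wpDr.
apply: dP; rewrite l1prod_normE/=.
apply: (@le_lt_trans _ _ (`|u - x| * (1 + L))); first by lra.
by rewrite -ltr_pdivlMr// ltr_wpDr.
Qed.

Lemma frechet_differentiable_dual Z (f : Z -> \bar R) (z : Z) :
  frechet_differentiable f z -> dual (gradient f z).
Proof.
move=> [_ df]; split; first exact: linearP.
exact: diff_continuous.
Qed.

Lemma frechet_differentiable_near Z (f : Z -> \bar R) (z : Z) (eps : R) :
  frechet_differentiable f z -> 0 < eps ->
  \forall w \near z, f w \is a fin_num /\
    `|fine (f w) - fine (f z) - gradient f z (w - z)| <= eps * `|w - z|.
Proof.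
move=> [finf df] eps0; apply: filterI => //.
have /eqaddoP/(_ _ eps0) := diff_locally df; rewrite /= => /near_normP[d d0 dP].
apply/near_normP; exists d => // w wz.
have := dP (w - z); rewrite subr0 => /(_ wz).
by rewrite !fctE/= subrK opprD addrA.
Qed.

End Functionals.

Section MarginalFunction.
Context (R : realType) (X Y : normedModType R).
Implicit Types (phi : l1prod X Y -> \bar R) (G : X -> set Y).

Lemma calm_image_norm (y v : Y) (r : R) : 0 <= r ->
  [set y + r *: b | b in [set b : Y | `|b| <= 1]] v -> `|v - y| <= r.
Proof.
move=> r0 [b /= b1 <-].
by rewrite addrAC subrr add0r normrZ ger0_norm// ler_piMr.
Qed.

(** Under the first two conditions the feasible points that matter already satisfy the calmness
    bound; under the third the selection is a minimizer satisfying it. The point [xbar] is excluded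
    because isolated calmness does not constrain [G xbar]. *)
Lemma marginal_calm_restriction phi G (xbar : X) (ybar : Y) :
  [\/ semilocally_nearly_isolated_calm G xbar ybar,
      locally_nearly_isolated_calm G xbar ybar /\
      (forall eps : R, 0 < eps -> exists2 gamma : R, 0 < gamma &
         forall x, ball xbar gamma x ->
           marginal phi G x =
             ereal_inf [set phi (x, y) | y in G x `&` ball ybar eps]) |
      upper_Lipschitzian_selection (dom G) (solution_map phi G) xbar ybar] ->
  exists2 L : R, 0 <= L & \forall x \near xbar, x != xbar ->
    (ereal_inf [set phi (x, y) | y in
        G x `&` [set y | (`|y - ybar| <= L * `|x - xbar|)%R]]
     <= marginal phi G x)%E.
Proof.
case=> [[L [gamma [L0 g0 calm]]]|[[L [gamma [L0 g0 calm]]] loc]|].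
- exists L; first exact: ltW.
  apply/nbhs_ballP; exists gamma => // x xg xx.
  apply: ereal_inf_le_tmp => _ [y Gy <-]; exists y => //; split=> //=.
  apply: calm_image_norm; first by rewrite mulr_ge0// ltW.
  by apply: calm Gy; split=> //; exact/eqP.
- exists L; first exact: ltW.
  (* Localizing at the calmness radius [gamma] leaves only points of [G x] to which calmness
     applies. *)
  have [delta d0 locd] := loc _ g0.
  apply/nbhs_ballP; exists (Num.min gamma delta); first by rewrite /= lt_min g0.
  move=> x xg xx; rewrite locd; last first.
    by apply: le_ball xg; rewrite ge_min lexx orbT.
  apply: ereal_inf_le_tmp => _ [y Gy <-]; exists y => //; split; first by case: Gy.
  apply: calm_image_norm; first by rewrite mulr_ge0// ltW.
  apply: calm Gy; split; last exact/eqP.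
  by apply: le_ball xg; rewrite ge_min lexx.
- move=> [h [hx hM [r [l [r0 l0 hl]]]]]; exists l => //.
  have xr : \forall x \near xbar, ball xbar r x by exact: nbhsx_ballx.
  apply: filterS (filterI hM xr) => x [hMx xrx] _.
  (* Outside [dom G] the marginal value is [+oo], an infimum over the empty set. *)
  have [Gx|Gx] := pselect (dom G x); last first.
    rewrite /marginal (_ : [set phi (x, y) | y in G x] = set0) ?ereal_inf0 ?leey//.
    by apply/seteqP; split=> // t [y Gy _]; apply: Gx; exists y.
  have [Ghx <-] := hMx Gx.
  apply: ereal_inf_lbound; exists (h x) => //; split=> //=.
  by rewrite -hx; apply: hl.
Qed.

Lemma marginal_le phi G x y : G x y -> (marginal phi G x <= phi (x, y))%E.
Proof. by move=> Gy; apply: ereal_inf_lbound; exists y. Qed.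

End MarginalFunction.

(** * The two equalities, each by double inclusion *)

Theorem theorem4p1 (R : realType) (X Y : normedModType R)
    (phi : l1prod X Y -> \bar R) (G : X -> set Y) (xbar : X) (ybar : Y)
    (phi_gtNy : forall p, (-oo < phi p)%E)
    (mu_fin : marginal phi G xbar \is a fin_num)
    (xbar_dom : dom (solution_map phi G) xbar)
    (ybar_sol : solution_map phi G xbar ybar)
    (phi_diff : frechet_differentiable phi (xbar, ybar))
    (conditions :
      [\/ semilocally_nearly_isolated_calm G xbar ybar,
          locally_nearly_isolated_calm G xbar ybar /\
          (forall eps : R, 0 < eps -> exists2 gamma : R, 0 < gamma &
             forall x, ball xbar gamma x ->
               marginal phi G x =
                 ereal_inf [set phi (x, y) | y in G x `&` ball ybar eps]) |
          upper_Lipschitzian_selection (dom G) (solution_map phi G) xbar ybar]) :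
  let xs : X -> R := gradient1 phi (xbar, ybar) in
  let ys : Y -> R := gradient2 phi (xbar, ybar) in
  regular_subdifferential (marginal phi G) xbar =
    [set xs \+ us | us in regular_coderivative G xbar ybar ys] /\
  singular_regular_subdifferential (marginal phi G) xbar =
    regular_coderivative G xbar ybar (cst 0).
Proof.
move=> xs ys.
have dgrad := frechet_differentiable_dual phi_diff.
have dxs : dual xs by exact: dual_left dgrad.
have dys : dual ys by exact: dual_right dgrad.
have gradE (p : l1prod X Y) : gradient phi (xbar, ybar) p = xs p.1 + ys p.2.
  have [_ _ gD] := scalar_additive (proj1 dgrad).
  rewrite -gD; congr gradient; apply: injective_projections => /=.
    by rewrite addr0.
  by rewrite add0r.
have phi_near (eps : R) := frechet_differentiable_near phi_diff (eps := eps).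
have [_ phi_mu] := ybar_sol; have Gy : G xbar ybar by case: ybar_sol.
have [L L0 mu_restr] := marginal_calm_restriction conditions.
have L1 : 0 < 1 + L by rewrite ltr_wpDr.
(* Optimality of [ybar] centres the expansion of [phi] at the value [mu xbar]. *)
rewrite phi_mu in phi_near.
set mu := marginal phi G in mu_fin mu_restr phi_near *.
set m := fine (mu xbar) in phi_near *.
have mE : mu xbar = m%:E by rewrite fineK.
split; apply/seteqP; split.
(* A subgradient [zs] gives the coderivative element [zs - xs]; the subgradient inequality and the
   expansion of [phi] each take half of [eps]. *)
- move=> zs /(regular_subdifferentialP _ mu_fin)[dzs subz].
  have dus : dual (zs \+ (\- xs)) by apply: dualD => //; exact: dualN.
  exists (zs \+ (\- xs)); last by apply/funext => x /=; lra.
  split=> //; apply/regular_normal_coneP; split.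
    by apply: dual_pair_functional => //; exact: dualN.
  move=> eps eps0; have e20 : 0 < eps / 2 by rewrite divr_gt0.
  have [d d0 dP] := (near_normP _ _).1 (subz _ e20).
  have [e e0 eP] := (near_normP _ _).1 (phi_near _ e20).
  apply/near_normP; exists (Num.min d e); first by rewrite lt_min d0.
  move=> -[x y]; rewrite lt_min => /andP[xd xe] /= Gxy.
  have [phifin] := eP _ xe.
  have {}xd : `|x - xbar| < d.
    by apply: le_lt_trans xd; rewrite l1prod_normE/= lerDl.
  have := le_trans (dP _ xd) (marginal_le phi Gxy).
  rewrite gradE !l1prod_normE /pair_functional/= -(fineK phifin) lee_fin -/m ler_norml.
  move=> + /andP[_].
  have := mulr_ge0 (ltW e20) (normr_ge0 (y - ybar)); lra.
- move=> _ [us [dus /regular_normal_coneP[_ usN]] <-].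
  apply/(regular_subdifferentialP _ mu_fin); split; first exact: dualD.
  move=> eps eps0.
  (* Two errors arise, from the normal inequality and from the expansion; each is at most
     [e * (1 + L) * |x - xbar|], half of the allowed error. *)
  pose e := eps / (2 * (1 + L)).
  have e0 : 0 < e by rewrite divr_gt0// mulr_gt0.
  have nearN := near_calm L0 (usN _ e0).
  have nearP := near_calm L0 (phi_near _ e0).
  near=> x; have [->|xx] := eqVneq x xbar.
    have [lin0 _ _] := scalar_additive (proj1 (dualD dxs dus)).
    by rewrite subrr lin0 normr0 mulr0 subr0 addr0 mE.
  have Hx : (ereal_inf [set phi (x, y) | y in
      G x `&` [set y | (`|y - ybar| <= L * `|x - xbar|)%R]] <= mu x)%E.
    by move: xx; near: x.
  apply: le_trans Hx; apply/ereal_infP => _ [y [Gxy /= yL] <-].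
  (* Here [y] depends on [x], so the bound is proved for all calm [y] at once before [x] is taken
     near [xbar]. *)
  have usy : G x y -> us (x - xbar) - ys (y - ybar) <=
      e * (`|x - xbar| + `|y - ybar|).
    by move: y yL {Gxy}; near: x.
  have [phifin] : phi (x, y) \is a fin_num /\
      `|fine (phi (x, y)) - m - gradient phi (xbar, ybar) ((x, y) - (xbar, ybar))|
      <= e * (`|x - xbar| + `|y - ybar|).
    by move: y yL {Gxy usy}; near: x.
  rewrite gradE -(fineK phifin) lee_fin -/m ler_norml/= => /andP[+ _].
  have := usy Gxy.
  have : e * (`|x - xbar| + `|y - ybar|) <= eps / 2 * `|x - xbar|.
    rewrite (_ : eps / 2 = e * (1 + L)).
      by rewrite -mulrA ler_pM2l//; lra.
    by rewrite /e; field; rewrite gt_eqF.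
  lra.
- move=> zs [dzs /regular_normal_coneP[_ zsN]]; split=> //.
  apply/regular_normal_coneP; split.
    by apply: dual_pair_functional => //; exact/dualN/dual_cst0.
  move=> eps eps0.
  have /dualP[_ [K K0 HK]] := dgrad.
  (* The expansion with error constant 1 bounds [|phi (x, y) - m|] by [K + 1] times the distance to
     [(xbar, ybar)]; adding [|x - xbar|] gives [K + 2]. *)
  have K2 : 0 < K + 2 by rewrite addr_gt0.
  have [d d0 dP] := (near_normP _ _).1 (zsN _ (divr_gt0 eps0 K2)).
  have [e e0 eP] := (near_normP _ _).1 (phi_near _ ltr01).
  apply/near_normP; exists (Num.min (d / (K + 2)) e).
    by rewrite lt_min e0 divr_gt0.
  move=> -[x y]; rewrite lt_min => /andP[xd xe] /= Gxy.
  have [phifin phile] := eP _ xe.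
  have alphale : `|x - xbar| + `|fine (phi (x, y)) - m| <=
      (K + 2) * `|((x, y) : l1prod X Y) - (xbar, ybar)|.
    have := HK (((x, y) : l1prod X Y) - (xbar, ybar)).
    have := ler_normD (fine (phi (x, y)) - m -
      gradient phi (xbar, ybar) (((x, y) : l1prod X Y) - (xbar, ybar)))
      (gradient phi (xbar, ybar) (((x, y) : l1prod X Y) - (xbar, ybar))).
    rewrite subrK; move: phile; rewrite !l1prod_normE/=.
    have := normr_ge0 (y - ybar); lra.
  have := dP (x, fine (phi (x, y))).
  rewrite l1prod_normE/= => /(_ _ _).
  rewrite /pair_functional/= subr0 addr0 => H.
  apply: (le_trans (H _ _)).
  + by apply: le_lt_trans alphale _; rewrite mulrC -ltr_pdivlMr.
  + by rewrite /epi/= fineK// marginal_le.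
  + by rewrite -mulrA ler_pM2l// mulrC ler_pdivrMr// mulrC.
- move=> zs [dzs /regular_normal_coneP[_ zsN]]; split=> //.
  apply/regular_normal_coneP; split.
    by apply: dual_pair_functional => //; exact: dual_cst0.
  move=> eps eps0.
  (* The factor [1 + L] is lost when the distance from [(x, y)] to [(xbar, ybar)] is bounded through
     [|x - xbar|]. *)
  have e0 : 0 < eps / (1 + L) by rewrite divr_gt0.
  have [d d0 dP] := (near_normP _ _).1
    (filterI mu_restr (near_calm L0 (zsN _ e0))).
  apply/near_normP; exists d => // -[x a]; rewrite l1prod_normE/= => xd mua.
  have {}xd : `|x - xbar| < d by apply: le_lt_trans xd; rewrite lerDl.
  rewrite /pair_functional/= addr0.
  have [->|xx] := eqVneq x xbar.
    have [zs0 _ _] := scalar_additive (proj1 dzs).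
    by rewrite subrr zs0 mulr_ge0// ?addr_ge0// ltW.
  have [Hx HN] := dP _ xd.
  (* Since [mu x <= a < +oo], the restricted infimum is not over the empty set. Any calm feasible
     [y] suffices, as the functional ignores the second component. *)
  have : (ereal_inf [set phi (x, y) | y in
      G x `&` [set y | (`|y - ybar| <= L * `|x - xbar|)%R]] < +oo)%E.
    by apply: le_lt_trans (Hx xx) _; apply: le_lt_trans mua _; rewrite ltry.
  move=> /ereal_inf_lt[_ [y [Gxy /= yL] _] _].
  have := HN _ yL Gxy; rewrite /pair_functional/= subr0 l1prod_normE/=.
  move=> /le_trans; apply.
  rewrite mulrAC ler_pdivrMr// -mulrA ler_pM2l// mulrDl.
  have := normr_ge0 (a - m); have := mulr_ge0 L0 (normr_ge0 (a - m)); lra.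
Unshelve. all: by end_near. Qed.
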